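(* Let $X$ be a countable set, let $f:X\to X$ be a map satisfying the bounded condition with respect to a partition $X=X_1\sqcup\cdots\sqcup X_k$, and let $T_1,\dots,T_k\in\mathcal{B}(\mathcal{H})$ be the associated partial isometries. Then there exists an injective, order-preserving map (both families being ordered by inclusion) from $$\{K\subseteq X \mid K \text{ is an } f\text{-invariant set}\}$$ to $$\{\mathcal{M}\subseteq\mathcal{H}\mid \mathcal{M}\text{ is a reducing subspace for } C^*(T_1,\dots,T_k)\}.$$
   Context: Let $X$ be a countable (finite or countably infinite) set, without topology, and $f:X\to X$ a map (not necessarily injective or surjective). Bounded condition: $f$ satisfies the bounded condition if there are $k\in\mathbb{N}$ and mutually disjoint subsets $X_1,\dots,X_k$ of $X$ with $\bigcup_{i=1}^k X_i=X$ such that each restriction $f|_{X_i}$ is injective. Such a partition is fixed. Associated operators: $\mathcal{H}$ is a complex Hilbert space with $\dim\mathcal{H}=|X|$ and complete orthonormal system $\{e_x\}_{x\in X}$; $\mathcal{B}(\mathcal{H})$ is the algebra of bounded linear operators on $\mathcal{H}$. For $1\le i\le k$, $T_i\in\mathcal{B}(\mathcal{H})$ is the partial isometry with $T_ie_x=e_{f(x)}$ if $x\in X_i$ and $T_ie_x=0$ if $x\notin X_i$. $C^*(T_1,\dots,T_k)$ is the $C^*$-subalgebra of $\mathcal{B}(\mathcal{H})$ generated by $T_1,\dots,T_k$. $f$-invariant set: a subset $K\subseteq X$ with $f(K)\subseteq K$ and $f^{-1}(K)\subseteq K$ (the empty set is allowed). Reducing subspace for a set $\mathcal{S}\subseteq\mathcal{B}(\mathcal{H})$: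 a closed subspace $\mathcal{M}\subseteq\mathcal{H}$ with $T\mathcal{M}\subseteq\mathcal{M}$ and $T^*\mathcal{M}\subseteq\mathcal{M}$ for every $T\in\mathcal{S}$. *)

(* Defs.v *)
From HB Require Import structures.
From mathcomp Require Import all_boot all_order all_algebra.
From mathcomp Require Import all_classical all_reals all_analysis.
From mathcomp Require Export complex.

Set Implicit Arguments.
Unset Strict Implicit.
Unset Printing Implicit Defensive.

Import Order.TTheory GRing.Theory Num.Theory Num.Def.
Import numFieldNormedType.Exports.

Local Open Scope classical_set_scope.
Local Open Scope ring_scope.

Section Dynamics.
Context {X : Type}.
Implicit Types (f : X -> X) (K : set X).

Definition bounded_condition f (k : nat) (P : 'I_k -> set X) : Prop :=
  [/\ trivIset setT P, \bigcup_i P i = setT & forall i, set_inj (P i) f].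

Definition invariant_set f K : Prop := f @` K `<=` K /\ f @^-1` K `<=` K.

End Dynamics.

(* A complex Hilbert space is a complete normed module H over R[i] with a
   positive definite hermitian form dot, linear in its first argument and
   conjugate-linear in the second, which induces the norm. *)
Definition inner_product_norm (R : realType) (H : completeNormedModType R[i])
    (dot : {dot H for @conjC R[i]}) : Prop :=
  forall u : H, dot u u = `|u| ^+ 2.

Section Operators.
Context {R : realType} {H : completeNormedModType R[i]}.
Variable dot : {dot H for @conjC R[i]}.
Implicit Types (T S : H -> H) (A : set (H -> H)) (M : set H).

Definition complete_orthonormal_system (X : eqType) (e : X -> H) : Prop :=
  (forall x y, dot (e x) (e y) = (x == y)%:R) /\
  (forall u, (forall x, dot u (e x) = 0) -> u = 0).

Definition bounded_operator T : Prop :=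
  linear T /\ exists c : R[i], forall u, `|T u| <= c * `|u|.

(* The norm of H takes its values in R[i], whence the real part. *)
Definition operator_norm T : R :=
  sup [set complex.Re `|T u| | u in [set u : H | `|u| <= 1]].

(* For a bounded operator T the adjoint exists (Riesz) and is unique, so
   xget takes its default value 0 for no bounded operator. *)
Definition adjoint T : H -> H :=
  xget (0 : H -> H) [set S | forall u v, dot (T u) v = dot u (S v)].

(* Isometric on the orthogonal complement of the kernel. *)
Definition partial_isometry T : Prop :=
  forall u, (forall v, T v = 0 -> dot u v = 0) -> `|T u| = `|u|.

(* Not required to contain the identity operator. *)
Record cstar_subalgebra A : Prop := CstarSubalgebra {
  cstar_bounded : A `<=` bounded_operator ;
  cstar_zero : A (0 : H -> H) ;
  cstar_add : forall T S, A T -> A S -> A (T + S) ;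
  cstar_scale : forall (a : R[i]) T, A T -> A (a *: T) ;
  cstar_mul : forall T S, A T -> A S -> A (T \o S) ;
  cstar_adjoint : forall T, A T -> A (adjoint T) ;
  cstar_closed : forall T, bounded_operator T ->
    (forall eps : R, 0 < eps -> exists2 S, A S & operator_norm (T - S) < eps) ->
    A T
}.

Definition generated_cstar (G : set (H -> H)) : set (H -> H) :=
  smallest cstar_subalgebra G.

Record closed_subspace M : Prop := ClosedSubspace {
  subspace_zero : M 0 ;
  subspace_add : forall u v, M u -> M v -> M (u + v) ;
  subspace_scale : forall (a : R[i]) u, M u -> M (a *: u) ;
  subspace_closed : closed M
}.

Definition reducing_subspace (G : set (H -> H)) M : Prop :=
  closed_subspace M /\
  forall T, G T -> T @` M `<=` M /\ adjoint T @` M `<=` M.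

(* T is the family of partial isometries attached to f and the partition P. *)
Definition associated_operators (X : Type) (f : X -> X) (k : nat)
    (P : 'I_k -> set X) (e : X -> H) (T : 'I_k -> H -> H) : Prop :=
  forall i, [/\ bounded_operator (T i), partial_isometry (T i),
    forall x, P i x -> T i (e x) = e (f x)
    & forall x, ~ P i x -> T i (e x) = 0].

End Operators.

(* Main.v *)
Require Import Defs.
From mathcomp Require Import all_boot all_order all_algebra.
From mathcomp Require Import all_classical all_reals all_analysis.
From mathcomp Require Import lra ring.
Import Order.TTheory GRing.Theory Num.Theory Num.Def.
Import numFieldNormedType.Exports.
Local Open Scope classical_set_scope.
Local Open Scope ring_scope.

(* Send K to the closed span of the e_x with x in K, realised as the set of
   vectors orthogonal to every e_y with y outside K; membership of e_x in it
   recovers K.  An operator reduces this space M when it preserves both M and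
   its orthogonal complement, and the bounded operators doing so form a
   C*-subalgebra, so it suffices to treat T_i.  There the adjoint, which exists
   by the Riesz representation theorem, sends e_y to e_x if x in X_i satisfies
   f x = y, and to 0 if there is no such x: orthogonality relations for T_i then
   reduce to f-invariance of K. *)

(** * Inner products, vectors of least norm and Riesz representation *)

Lemma dot_cauchy_schwarz (C : numClosedFieldType) (U : lmodType C)
    (dot : {dot U for @conjC C}) (u v : U) :
  `|dot u v| ^+ 2 <= dot u u * dot v v.
Proof.
have [->|v0] := eqVneq v 0.
  by rewrite linear0r normr0 expr0n mulr_ge0 ?dnorm_ge0.
have vv := neq0_dnorm_gt0 (s := dot) v v0.
(* [w] is the part of [u] orthogonal to [v]; by Pythagoras the right side exceeds the left by
   [dot w w * dot v v]. *)
pose a := dot u v / dot v v; pose w := u - a *: v.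
have wv : dot w v = 0.
  by rewrite linearBl/= linearZl_LR/= divfK ?subrr// gt_eqF.
have -> : u = w + a *: v by rewrite subrK.
rewrite linearDl/= wv add0r linearZl_LR/= normrM (ger0_norm (ltW vv)).
rewrite exprMn mulrA [dot (w + _) _]hnormDd; last first.
  by rewrite linearZr_LR/= wv mulr0.
by rewrite mulrDl -(dnormZ dot) lerDr mulr_ge0 ?dnorm_ge0.
Qed.

Section HilbertSpace.
Local Open Scope complex_scope.
Set Implicit Arguments.
Unset Strict Implicit.
Context {R : realType} {H : completeNormedModType R[i]}.
Variable dot : {dot H for @conjC R[i]}.
Hypothesis dot_norm : inner_product_norm dot.
Implicit Types (T S : H -> H) (u v w : H) (B M : set H).

Lemma dotC_eq0 u v : dot u v = 0 -> dot v u = 0.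
Proof. by move=> /eqP; rewrite herm_eq0C => /eqP. Qed.

Lemma norm_dot_le u v : `|dot u v| <= `|u| * `|v|.
Proof.
rewrite -(@ler_pXn2r _ 2) ?nnegrE ?mulr_ge0//.
by rewrite exprMn -!dot_norm dot_cauchy_schwarz.
Qed.

Lemma norm_Re (V : normedModType R[i]) (u : V) : (complex.Re `|u|)%:C = `|u|.
Proof. by rewrite RRe_real// normr_real. Qed.

Lemma dot_parallelogram u v :
  `|u - v| ^+ 2 = 2 * `|u| ^+ 2 + 2 * `|v| ^+ 2 - `|u + v| ^+ 2.
Proof. rewrite -!dot_norm (dnormB dot) (dnormD dot) /=; ring. Qed.

Lemma closed_lipschitz_fiber (g : H -> R[i]) (c a : R[i]) :
  (forall u v, `|g u - g v| <= c * `|u - v|) -> closed [set u | g u = a].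
Proof.
move=> gc; apply: (@preimage_closed _ R[i]^o g [set a]); last first.
  apply: accessible_closed_set1; apply: hausdorff_accessible.
  exact: norm_hausdorff.
move=> u _; apply/cvgrPdist_lt => eps eps0; near=> v.
(* [c] is any complex number, but its product with the distance dominates a norm, hence is
   nonnegative and equal to its own modulus. *)
have cv : c * `|u - v| <= `|c| * `|u - v|.
  rewrite -[`|u - v| in leRHS]normr_id -normrM ger0_norm//.
  by rewrite (le_trans _ (gc u v)).
apply: (le_lt_trans (gc u v)); apply: (le_lt_trans cv).
have c1 : 0 < `|c| + 1 by rewrite ltr_wpDl.
apply: (@le_lt_trans _ _ ((`|c| + 1) * `|u - v|)).
  by rewrite ler_wpM2r// lerDl.
rewrite mulrC -ltr_pdivlMr//; near: v.
by apply: cvgr_dist_lt => //; rewrite divr_gt0.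
Unshelve. all: by end_near. Qed.

(** A minimising sequence is Cauchy by the parallelogram law, since midpoints stay in [M];
    completeness gives a limit and closedness keeps it in [M]. *)
Lemma exists_min_norm M : closed M -> M !=set0 ->
  (forall u v, M u -> M v -> M (2^-1 *: (u + v))) ->
  exists2 z, M z & forall v, M v -> `|z| <= `|v|.
Proof.
move=> clM [m0 Mm0] midM.
pose N (u : H) : R := complex.Re `|u|.
have NE u : (N u)%:C = `|u| by exact: norm_Re.
have N0 u : 0 <= N u by rewrite -lecR NE; exact: (normr_ge0 u).
pose E := [set N u | u in M].
have infE : has_inf E by split; [exists (N m0), m0|exists 0 => _ [u _ <-]].
pose m := inf E.
have m_ge0 : 0 <= m by apply: lb_le_inf; [exists (N m0), m0|move=> _ [u _ <-]].
have m_le v : M v -> m <= N v.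
  by move=> Mv; apply: inf_lbound; [case: infE|exists v].
have /choice[s sP] : forall n, exists u, M u /\ N u < m + n.+1%:R^-1.
  move=> n; have [|_ [u Mu <-] ?] := @inf_adherent _ E n.+1%:R^-1 _ infE.
    by rewrite invr_gt0.
  by exists u.
(* The bound comes from 4(m + d)^2 - 4m^2 = 4d(2m + d) and [d <= 1]. *)
have sdist (d : R) u v : 0 < d -> d <= 1 -> M u -> M v ->
    N u < m + d -> N v < m + d ->
    N (u - v) ^+ 2 <= 4 * d * (2 * m + 1).
  move=> d0 d1 Mu Mv ud vd.
  (* Parallelogram law: the midpoint of u and v still has norm at least m. *)
  have := m_le _ (midM _ _ Mu Mv).
  have par : N (u - v) ^+ 2 = 2 * N u ^+ 2 + 2 * N v ^+ 2 - N (u + v) ^+ 2.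
    apply: complexI; rewrite (rmorphXn (real_complex R))/= NE dot_parallelogram.
    rewrite -!NE (rmorphB (real_complex R)) (rmorphD (real_complex R))/=.
    rewrite !(rmorphM (real_complex R))/= !(rmorph_nat (real_complex R)).
    by rewrite !expr2.
  rewrite [leRHS](_ : _ = 2^-1 * N (u + v)); last first.
    apply: complexI; rewrite NE normrZ ger0_norm ?invr_ge0// -NE.
    rewrite (rmorphM (real_complex R))/= (fmorphV (real_complex R))/=.
    by rewrite (rmorph_nat (real_complex R)).
  move=> mid; rewrite par.
  have := N0 u; have := N0 v; nra.
have /cvg_ex[z zP] : cvg (s @ \oo).
  apply/cauchy_cvgP; apply: cauchy_exP => eps eps0.
  have [r r0 rE] : exists2 r : R, 0 < r & r%:C = eps.
    exists (complex.Re eps); last by rewrite RRe_real// gtr0_real.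
    by rewrite -ltcR RRe_real// gtr0_real.
  have [n [n1 nr]] : exists n, n.+1%:R^-1 <= 1 :> R /\
      4 * n.+1%:R^-1 * (2 * m + 1) < r ^+ 2.
    have m4 : 0 < 4 * (2 * m + 1) by rewrite mulr_gt0// ltr_wpDl// mulr_ge0.
    have q0 : 0 < r ^+ 2 / (4 * (2 * m + 1)) by rewrite divr_gt0 ?exprn_gt0.
    have [n _ /(_ n (leqnn _))/= nP] := near_infty_natSinv_lt (PosNum q0).
    exists n; split; first by rewrite invf_le1 ?ler1n.
    move: nP; rewrite ltr_pdivlMr//.
    by rewrite [4 * n.+1%:R^-1]mulrC mulrA.
  exists (s n); exists n => //= k nk.
  rewrite -ball_normE /= -rE -NE ltcR.
  rewrite -(@ltr_pXn2r _ 2) ?nnegrE// ?(ltW r0)//.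
  apply: le_lt_trans nr; apply: sdist.
  - by rewrite invr_gt0.
  - exact: n1.
  - exact: (sP n).1.
  - exact: (sP k).1.
  - exact: (sP n).2.
  - apply: (lt_le_trans (sP k).2); rewrite lerD2l lef_pV2 ?posrE ?ltr0n//.
    by rewrite ler_nat ltnS.
have Mz : M z.
  apply: (@closed_cvg _ _ \oo eventually_filter s M clM _ z zP).
  by apply: nearW => n; exact: (sP n).1.
exists z => // v Mv; rewrite -!NE lecR.
apply: (le_trans _ (m_le _ Mv)); apply/ler_addgt0Pr => eps eps0.
have eps2 : 0 < eps / 2 by rewrite divr_gt0.
have [n _ /(_ n (leqnn _))/= nP] : \forall n \near \oo,
    `|z - s n| < (eps / 2)%:C /\ n.+1%:R^-1 < eps / 2.
  near=> n; split.
    by near: n; apply: cvgr_dist_lt => //; rewrite ltcR.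
  by near: n; exact: (near_infty_natSinv_lt (PosNum eps2)).
have [zs ns] := nP.
have : N z <= N (z - s n) + N (s n).
  rewrite -lecR (rmorphD (real_complex R))/= !NE.
  by rewrite -{1}(subrK (s n) z) ler_normD.
have : N (z - s n) < eps / 2 by rewrite -ltcR NE.
have := (sP n).2; move: ns; move: (n.+1%:R^-1) => q; lra.
Unshelve. all: by end_near. Qed.

Lemma riesz_representation (phi : H -> R[i]) (c : R[i]) :
  (forall a u v, phi (a *: u + v) = a * phi u + phi v) ->
  (forall u, `|phi u| <= c * `|u|) ->
  exists w, forall u, phi u = dot u w.
Proof.
move=> philin phic.
have phi0 : phi 0 = 0.
  have /eqP := philin 1 0 0; rewrite scale1r addr0 mul1r -subr_eq0 opprD.
  by rewrite addrA subrr sub0r oppr_eq0 => /eqP.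
have phiZ a u : phi (a *: u) = a * phi u.
  by rewrite -[a *: u]addr0 philin phi0 addr0.
have phiD u v : phi (u + v) = phi u + phi v.
  by rewrite -[u]scale1r philin mul1r scale1r.
have phiB u v : phi (u - v) = phi u - phi v.
  by rewrite phiD -scaleN1r phiZ mulN1r.
have [[u0 phiu0]|] := pselect (exists u, phi u != 0); last first.
  move=> /forallNP noz; exists 0 => u; rewrite linear0r.
  by apply/eqP; move: (noz u) => /negP; rewrite negbK.
(* The element of least norm of [phi = 1] is orthogonal to the kernel of phi. *)
have [|||z phiz zmin] := @exists_min_norm [set u | phi u = 1].
- by apply: (@closed_lipschitz_fiber phi c) => u v; rewrite -phiB.
- by exists ((phi u0)^-1 *: u0); rewrite /= phiZ mulVf.
- by move=> u v /= u1 v1; rewrite phiZ phiD u1 v1; field.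
have orth v : phi v = 0 -> dot v z = 0.
  move=> v0; have [->|vn0] := eqVneq v 0; first by rewrite linear0l.
  have vv := neq0_dnorm_gt0 (s := dot) v vn0.
  (* As [phi v = 0], removing from [z] its projection on [v] stays in [phi = 1]; minimality and
     Pythagoras then force [a *: v = 0]. *)
  pose a := dot z v / dot v v; pose w := z - a *: v.
  have wv : dot w v = 0.
    by rewrite linearBl/= linearZl_LR/= divfK ?subrr// gt_eqF.
  have /zmin zw : phi w = 1 by rewrite phiB phiZ v0 mulr0 subr0.
  have zE : z = w + a *: v by rewrite subrK.
  have : `|z| ^+ 2 <= `|w| ^+ 2 by rewrite ler_pXn2r ?nnegrE.
  rewrite -!dot_norm [in leLHS]zE [dot (w + _) _]hnormDd; last first.
    by rewrite linearZr_LR/= wv mulr0.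
  rewrite gerDl => av_le0.
  have /eqP : a *: v = 0.
    apply/eqP/negPn/negP => /(neq0_dnorm_gt0 (s := dot)) /lt_le_trans.
    by move=> /(_ _ av_le0); rewrite ltxx.
  rewrite scaler_eq0 (negPf vn0) orbF mulf_eq0 invr_eq0 (gt_eqF vv) orbF.
  by move=> /eqP; exact: dotC_eq0.
have z0 : z != 0.
  by apply: contra_eq_neq phiz => ->; rewrite phi0 eq_sym oner_eq0.
have zz := neq0_dnorm_gt0 (s := dot) z z0.
(* [u - phi u *: z] lies in the kernel, so [dot u z] is [phi u * dot z z]; the scalar is real, so
   conjugation fixes it. *)
exists ((dot z z)^-1 *: z) => u.
have /orth : phi (u - phi u *: z) = 0 by rewrite phiB phiZ phiz mulr1 subrr.
rewrite linearBl/= linearZl_LR/= => /eqP; rewrite subr_eq0 => /eqP uz.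
rewrite linearZr_LR/= uz fmorphV/= conj_Creal ?gtr0_real//.
by rewrite mulrC mulfK// gt_eqF.
Qed.

End HilbertSpace.

(** * Algebra of bounded operators and the operator norm *)

Section BoundedOperators.
Local Open Scope complex_scope.
Set Implicit Arguments.
Unset Strict Implicit.
Context {R : realType} {H : completeNormedModType R[i]}.
Implicit Types (T S : H -> H) (u v w : H).

Lemma bounded_operatorD T u v : bounded_operator T -> T (u + v) = T u + T v.
Proof. by move=> [lT _]; rewrite -[u]scale1r lT !scale1r. Qed.

Lemma bounded_operator0 T : bounded_operator T -> T 0 = 0.
Proof.
move=> bT; have /eqP := bounded_operatorD 0 0 bT.
by rewrite addr0 -subr_eq0 opprD addrA subrr sub0r oppr_eq0 => /eqP.
Qed.

Lemma bounded_operatorZ T a u : bounded_operator T -> T (a *: u) = a *: T u.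
Proof. by move=> bT; rewrite -[a *: u]addr0 bT.1 bounded_operator0// addr0. Qed.

(** The modulus of the complex constant in [bounded_operator] serves as a real one. *)
Lemma bounded_operator_bound T : bounded_operator T ->
  exists2 c : R, 0 <= c & forall u, `|T u| <= c%:C * `|u|.
Proof.
move=> [_ [c cT]]; exists (complex.Re `|c|).
  by rewrite -lecR RRe_real ?normr_real//; exact: (normr_ge0 c).
move=> u; rewrite RRe_real ?normr_real//.
by rewrite -[`|u|]normr_id -normrM ger0_norm// (le_trans _ (cT u)).
Qed.

Lemma bounded_operator_zero : bounded_operator (0 : H -> H).
Proof.
split; first by move=> a u v; rewrite [RHS]addr0 scaler0.
by exists 0 => u; rewrite normr0 mul0r.
Qed.

Lemma bounded_operator_add T S :
  bounded_operator T -> bounded_operator S -> bounded_operator (T + S).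
Proof.
move=> bT bS; split.
  by move=> a u v; rewrite /= !addrfctE bT.1 bS.1 scalerDr addrACA.
have [c _ cT] := bounded_operator_bound bT.
have [d _ dS] := bounded_operator_bound bS.
exists (c%:C + d%:C) => u; rewrite mulrDl.
by apply: (le_trans (ler_normD _ _)); apply: lerD.
Qed.

Lemma bounded_operator_scale (a : R[i]) T :
  bounded_operator T -> bounded_operator (a *: T).
Proof.
move=> bT; split.
  by move=> b u v; rewrite /= !scalrfctE bT.1 scalerDr !scalerA mulrC.
have [c _ cT] := bounded_operator_bound bT.
by exists (`|a| * c%:C) => u; rewrite normrZ -mulrA ler_wpM2l.
Qed.

Lemma bounded_operator_comp T S :
  bounded_operator T -> bounded_operator S -> bounded_operator (T \o S).
Proof.
move=> bT bS; split; first by move=> a u v; rewrite /= bS.1 bT.1.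
have [c c0 cT] := bounded_operator_bound bT.
have [d _ dS] := bounded_operator_bound bS.
exists (c%:C * d%:C) => u; apply: (le_trans (cT _)).
by rewrite -mulrA ler_wpM2l// lecR.
Qed.

(** Boundedness makes [sup] a genuine supremum; homogeneity reduces to a unit vector. *)
Lemma norm_le_operator_norm T u :
  bounded_operator T -> `|T u| <= (operator_norm T)%:C * `|u|.
Proof.
move=> bT; have [c c0 cT] := bounded_operator_bound bT.
have [->|u0] := eqVneq u 0; first by rewrite bounded_operator0// !normr0 mulr0.
have nu : 0 < `|u| by rewrite normr_gt0.
have nu' : `| `|u|^-1 *: u| = 1.
  by rewrite normrZ ger0_norm ?invr_ge0// mulVf// gt_eqF.
suff : `|T (`|u|^-1 *: u)| <= (operator_norm T)%:C.
  by rewrite bounded_operatorZ// normrZ ger0_norm ?invr_ge0// mulrC ler_pdivrMr.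
rewrite -norm_Re lecR; apply: sup_upper_bound; last first.
  by exists (`|u|^-1 *: u) => //=; rewrite nu'.
split.
  exists (complex.Re `|T (`|u|^-1 *: u)|), (`|u|^-1 *: u) => //=.
  by rewrite nu'.
exists c => _ [v /= v1 <-]; rewrite -lecR norm_Re (le_trans (cT v))//.
by rewrite -[leRHS]mulr1 ler_wpM2l// lecR.
Qed.

End BoundedOperators.

(** * Adjoints, and the C*-algebra of operators reduced by an orthogonal complement *)

Section OrthogonalComplement.
Local Open Scope complex_scope.
Set Implicit Arguments.
Unset Strict Implicit.
Context {R : realType} {H : completeNormedModType R[i]}.
Variable dot : {dot H for @conjC R[i]}.
Hypothesis dot_norm : inner_product_norm dot.
Implicit Types (T S : H -> H) (u v w : H) (B : set H).

Lemma dot_inj u v : (forall w, dot w u = dot w v) -> u = v.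
Proof.
move=> uv; apply/eqP; rewrite -subr_eq0 -normr_eq0 -(sqrf_eq0 `|_|).
by rewrite -dot_norm linearBr/= uv subrr.
Qed.

(** For fixed [v], Riesz represents the bounded functional sending [u] to [dot (T u) v]; so [xget]
    finds a true adjoint and not its default 0. *)
Lemma adjointP T u v :
  bounded_operator T -> dot (T u) v = dot u (adjoint dot T v).
Proof.
move=> bT.
suff /(xgetPex (0 : H -> H)) :
  exists S, forall u v, dot (T u) v = dot u (S v) by exact.
have [c _ cT] := bounded_operator_bound bT.
suff /choice[S ST] : forall v, exists w, forall u, dot (T u) v = dot u w.
  by exists S => u' v'; rewrite ST.
move=> {u}v; apply: (riesz_representation dot_norm (c := c%:C * `|v|)).
  by move=> a u w; rewrite bT.1 linearDl/= linearZl_LR.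
move=> u; apply: (le_trans (norm_dot_le dot_norm _ _)).
by rewrite [leRHS]mulrAC; apply: ler_wpM2r.
Qed.

(** With S the adjoint, the squared norm of Su is the inner product of TSu and u, at most c times
    the norms of Su and u; cancel one norm of Su. *)
Lemma bounded_operator_adjoint T :
  bounded_operator T -> bounded_operator (adjoint dot T).
Proof.
move=> bT; split.
  move=> a u v; apply: dot_inj => w.
  rewrite -adjointP// linearDr/= linearZr_LR/=.
  by rewrite linearDr/= linearZr_LR/= !adjointP.
have [c c0 cT] := bounded_operator_bound bT.
exists c%:C => u; have [->|Su0] := eqVneq (adjoint dot T u) 0.
  by rewrite normr0 mulr_ge0// lecR.
have nSu : 0 < `|adjoint dot T u| by rewrite normr_gt0.
rewrite -(ler_pM2l nSu) -expr2 -dot_norm -adjointP//.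
have dT : 0 <= dot (T (adjoint dot T u)) u by rewrite adjointP// dnorm_ge0.
rewrite -[leLHS]ger0_norm// (le_trans (norm_dot_le dot_norm _ _))//.
by rewrite [leRHS]mulrCA [leRHS]mulrA ler_wpM2r.
Qed.

(** [B] is any set of vectors: [orth B] is the candidate reducing subspace and [orth (orth B)] its
    orthogonal complement, so no span or closure is formed. *)
Definition orth B : set H := [set u | forall v, B v -> dot u v = 0].

Lemma orth_closed_subspace B : closed_subspace (orth B).
Proof.
split.
- by move=> v _; rewrite linear0l.
- by move=> u v Bu Bv w Bw; rewrite linearDl/= Bu// Bv// addr0.
- by move=> a u Bu w Bw; rewrite linearZl_LR/= Bu// mulr0.
- have -> : orth B = \bigcap_(v in B) [set u | dot u v = 0].
    by apply/seteqP; split.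
  apply: closed_bigI => v _.
  apply: (@closed_lipschitz_fiber _ _ (dot^~ v) `|v|) => u w.
  by rewrite -linearBl/= (le_trans (norm_dot_le dot_norm _ _))// mulrC.
Qed.

Definition preserves T B : Prop := T @` B `<=` B.

(** Handles norm limits: [dot (T u) v] equals [dot ((T - S) u) v], which Cauchy-Schwarz makes
    arbitrarily small. *)
Lemma operator_approx_orth (A : set (H -> H)) T u v : bounded_operator T ->
  A `<=` bounded_operator -> (forall S, A S -> dot (S u) v = 0) ->
  (forall eps : R, 0 < eps -> exists2 S, A S & operator_norm (T - S) < eps) ->
  dot (T u) v = 0.
Proof.
move=> bT bA Auv appr; apply/eqP; rewrite -normr_eq0 eq_le normr_ge0 andbT.
apply/ler_addgt0Pr => eps eps0; rewrite add0r.
(* The added 1 keeps the divisor positive when [u] or [v] is 0. *)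
pose d : R := complex.Re (eps / (`|u| * `|v| + 1)).
have uv0 : 0 < `|u| * `|v| + 1 by rewrite ltr_wpDl// mulr_ge0.
have d0 : 0 < eps / (`|u| * `|v| + 1) by rewrite divr_gt0.
have dE : d%:C = eps / (`|u| * `|v| + 1) by rewrite RRe_real// gtr0_real.
have [|S AS TS] := appr d; first by rewrite -ltcR dE.
have bTS : bounded_operator (T - S).
  rewrite -scaleN1r; apply: bounded_operator_add => //.
  exact/bounded_operator_scale/bA.
have -> : dot (T u) v = dot ((T - S) u) v.
  by rewrite (linearBl dot v (T u) (S u)) /= (Auv _ AS) subr0.
apply: (le_trans (norm_dot_le dot_norm _ _)).
apply: (@le_trans _ _ (d%:C * `|u| * `|v|)).
  rewrite ler_wpM2r// (le_trans (norm_le_operator_norm _ bTS))//.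
  by rewrite ler_wpM2r// lecR ltW.
rewrite dE -mulrA mulrAC ler_pdivrMr//.
by rewrite (ler_wpM2l (ltW eps0))// lerDl.
Qed.

(** Both subspaces are required for stability under adjoints: if [T] preserves one of them, its
    adjoint preserves the other. *)
Lemma cstar_subalgebra_orth_preserving B :
  cstar_subalgebra dot [set T | [/\ bounded_operator T,
    preserves T (orth B) & preserves T (orth (orth B))]].
Proof.
split.
- by move=> T [].
- split; first exact: bounded_operator_zero.
    by move=> _ [u Bu <-]; exact: subspace_zero (orth_closed_subspace B).
  by move=> _ [u Bu <-]; exact: subspace_zero (orth_closed_subspace (orth B)).
- move=> T S [bT TB TBB] [bS SB SBB]; split; first exact: bounded_operator_add.
    move=> _ [u Bu <-]; apply: (subspace_add (orth_closed_subspace B)).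
      by apply: TB; exists u.
    by apply: SB; exists u.
  move=> _ [u Bu <-]; apply: (subspace_add (orth_closed_subspace (orth B))).
    by apply: TBB; exists u.
  by apply: SBB; exists u.
- move=> a T [bT TB TBB]; split; first exact: bounded_operator_scale.
    move=> _ [u Bu <-]; apply: (subspace_scale (orth_closed_subspace B)).
    by apply: TB; exists u.
  move=> _ [u Bu <-]; apply: (subspace_scale (orth_closed_subspace (orth B))).
  by apply: TBB; exists u.
- move=> T S [bT TB TBB] [bS SB SBB]; split; first exact: bounded_operator_comp.
    by move=> _ [u Bu <-]; apply: TB; exists (S u) => //; apply: SB; exists u.
  by move=> _ [u Bu <-]; apply: TBB; exists (S u) => //; apply: SBB; exists u.
- move=> T [bT TB TBB]; split; first exact: bounded_operator_adjoint.
    (* [B] is contained in [orth (orth B)], so [T v] is orthogonal to [u]. *)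
    move=> _ [u Bu <-] v Bv; apply: dotC_eq0; rewrite -adjointP//.
    apply: TBB; last exact: Bu.
    by exists v => // w Bw; apply: dotC_eq0; exact: Bw.
  move=> _ [u Bu <-] v Bv; apply: dotC_eq0; rewrite -adjointP//.
  by apply: dotC_eq0; apply: Bu; apply: TB; exists v.
- move=> T bT appr; split => //.
    move=> _ [u Bu <-] v Bv; apply: (operator_approx_orth bT _ _ appr).
      by move=> S [].
    by move=> S [_ + _]; apply => //; exists u.
  move=> _ [u Bu <-] v Bv; apply: (operator_approx_orth bT _ _ appr).
    by move=> S [].
  by move=> S [_ _]; apply => //; exists u.
Qed.

(** By minimality the generated algebra lies in the algebra of the previous lemma, so generators
    suffice. *)
Lemma reducing_subspace_orth (G : set (H -> H)) B :
  (forall T, G T -> [/\ bounded_operator T,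
    preserves T (orth B) & preserves T (orth (orth B))]) ->
  reducing_subspace dot (generated_cstar dot G) (orth B).
Proof.
move=> GB; split; first exact: orth_closed_subspace.
move=> T /(smallest_sub (cstar_subalgebra_orth_preserving B) GB) TA.
split; first by case: TA.
by case: (cstar_adjoint (cstar_subalgebra_orth_preserving B) TA).
Qed.

End OrthogonalComplement.

(** * Invariant sets and the subspaces spanned by their basis vectors *)

Section InvariantSets.
Local Open Scope complex_scope.
Set Implicit Arguments.
Unset Strict Implicit.
Context {R : realType} {H : completeNormedModType R[i]}.
Variable dot : {dot H for @conjC R[i]}.
Hypothesis dot_norm : inner_product_norm dot.
Variables (X : eqType) (e : X -> H).
Hypothesis e_cons : complete_orthonormal_system dot e.

Lemma orth_basisP (K : set X) x : orth dot (e @` ~` K) (e x) <-> K x.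
Proof.
split=> [xK|Kx _ [y Ky <-]].
  apply: contrapT => Kx.
  have /eqP : dot (e x) (e x) = 0 by apply: xK; exists x.
  by rewrite e_cons.1 eqxx oner_eq0.
by rewrite e_cons.1; case: eqP => // xy; rewrite xy in Kx.
Qed.

Variables (f : X -> X) (k : nat) (P : 'I_k -> set X) (T : 'I_k -> H -> H).
Hypothesis f_inj : forall i, set_inj (P i) f.
Hypothesis fT : associated_operators dot f P e T.

(** The coefficient along [e z] is 1 if [z] is in [P i] with [f z = y], else 0. Injectivity on [P i]
    leaves at most one such [z], and completeness recovers the vector. *)
Lemma adjoint_associated_operator i y :
  (exists x, [/\ P i x, f x = y & adjoint dot (T i) (e y) = e x]) \/
  adjoint dot (T i) (e y) = 0.
Proof.
have [bT _ TP TN] := fT i.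
have dotS z : dot (e z) (adjoint dot (T i) (e y)) = (`[<P i z /\ f z = y>])%:R.
  rewrite -adjointP//; case: asboolP => [[Pz <-]|Nz].
    by rewrite TP// e_cons.1 eqxx.
  have [Pz|Pz] := pselect (P i z); last by rewrite TN// linear0l.
  by rewrite TP// e_cons.1; case: eqP => // fz; case: Nz.
have [[x [Px fx]]|Nx] := pselect (exists x, P i x /\ f x = y); [left|right].
  exists x; split => //; apply/eqP; rewrite -subr_eq0; apply/eqP.
  apply: e_cons.2 => z; apply: dotC_eq0; rewrite linearBr/= dotS e_cons.1.
  apply/eqP; rewrite subr_eq0; apply/eqP; congr (nat_of_bool _)%:R.
  apply/asboolP/eqP => [[Pz fz]|->//].
  exact: (f_inj (mem_set Pz) (mem_set Px) (etrans fz (esym fx))).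
apply: e_cons.2 => z; apply: dotC_eq0; rewrite dotS.
by case: asboolP => // -[Pz fz]; case: Nx; exists z.
Qed.

Lemma associated_operator_preserves (K : set X) i : invariant_set f K ->
  [/\ bounded_operator (T i), preserves (T i) (orth dot (e @` ~` K)) &
      preserves (T i) (orth dot (orth dot (e @` ~` K)))].
Proof.
move=> [fK fVK]; have [bT _ TP TN] := fT i; split => //.
  (* Forward invariance: a preimage of a point outside [K] is outside [K]. *)
  move=> _ [u uK <-] _ [y Ky <-]; rewrite adjointP//.
  have [[x [Px fx ->]]|->] := adjoint_associated_operator i y.
    by apply: uK; exists x => // Kx; apply: Ky; apply: fK; exists x.
  by rewrite linear0r.
(* It suffices that the adjoint sends [v] into [orth] of the basis vectors outside [K]. Backward
   invariance gives this: [f y] is outside [K] whenever [y] is. *)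
move=> _ [u uK <-] v vK; rewrite adjointP//; apply: uK => _ [y Ky <-].
apply: dotC_eq0; rewrite -adjointP//.
have [Py|Py] := pselect (P i y); last by rewrite TN// linear0l.
rewrite TP//; apply: dotC_eq0; apply: vK; exists (f y) => // Kfy.
exact/Ky/fVK.
Qed.

End InvariantSets.

Theorem theorem2p8 (R : realType) (X : countType) (f : X -> X)
    (k : nat) (P : 'I_k -> set X)
    (H : completeNormedModType R[i]) (dot : {dot H for @conjC R[i]})
    (e : X -> H) (T : 'I_k -> H -> H) :
  bounded_condition f P ->
  inner_product_norm dot ->
  complete_orthonormal_system dot e ->
  associated_operators dot f P e T ->
  exists Phi : set X -> set H,
    [/\ set_fun [set K | invariant_set f K]
          [set M | reducing_subspace dot (generated_cstar dot (range T)) M] Phi,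
        set_inj [set K | invariant_set f K] Phi
      & {in [set K | invariant_set f K] &,
          {homo Phi : K L / K `<=` L}}].
Proof.
move=> [_ _ f_inj] dot_norm e_cons fT.
exists (fun K => orth dot (e @` ~` K)); split.
- move=> K /= Kinv; apply: (reducing_subspace_orth dot_norm) => _ [i _ <-].
  exact: (associated_operator_preserves dot_norm e_cons f_inj fT).
- move=> K L _ _ /= KL; apply/seteqP; split=> x.
    by move=> /(orth_basisP e_cons) xK; apply/(orth_basisP e_cons); rewrite -KL.
  by move=> /(orth_basisP e_cons) xK; apply/(orth_basisP e_cons); rewrite KL.
(* A larger set leaves fewer basis vectors to be orthogonal to. *)
- move=> K L _ _ KL u uK _ [x Lx <-]; apply: uK; exists x => // Kx.
  exact/Lx/KL.
Qed.
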